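(* Let $(X,d,T)$ be a topological dynamical system and $\mu\in M(X,T)$. Then for $\mu$-a.e. $x\in X$, $$h_{\mu}(T,x)=\lim_{\delta\to0}\liminf_{n\to\infty}-\frac{\log\mu(B_{d_{FK_n}}(x,\delta))}{n}=\lim_{\delta\to0}\limsup_{n\to\infty}-\frac{\log\mu(B_{d_{FK_n}}(x,\delta))}{n}.$$
   Context: A topological dynamical system $(X,d,T)$ consists of a compact metric space $X$ with metric $d$ and a continuous map $T:X\to X$. $M(X,T)$ is the set of all $T$-invariant Borel probability measures on $X$. For $x,y\in X$, $\delta>0$ and $n\in\mathbb{N}$, an $(n,\delta)$-match of $x$ and $y$ is an order preserving bijection $\pi:D(\pi)\to R(\pi)$ (i.e. $\pi(i)<\pi(j)$ whenever $i<j$) with $D(\pi),R(\pi)\subset\{0,1,\ldots,n-1\}$ such that $d(T^ix,T^{\pi(i)}y)<\delta$ for every $i\in D(\pi)$. Let $|\pi|$ be the cardinality of $D(\pi)$. Set $$\bar f_{n,\delta}(x,y)=1-\frac{\max\{|\pi|:\pi\text{ is an }(n,\delta)\text{-match of }x\text{ and }y\}}{n},\qquad d_{FK_n}(x,y)=\inf\{\delta>0:\bar f_{n,\delta}(x,y)<\delta\},$$ and $B_{d_{FK_n}}(x,\delta)=\{y\in X:d_{FK_n}(x,y)<\delta\}$. The Bowen metric is $d_n(x,y)=\max_{0\le i\le n-1}d(T^ix,T^iy)$ and the Bowen ball is $B_n(x,\delta)=\{y\in X:d_n(x,y)<\delta\}$. The local entropy is $$h_\mu(T,x):=\lim_{\delta\to0}\liminf_{n\to\infty}-\frac{\log\mu(B_n(x,\delta))}{n}=\lim_{\delta\to0}\limsup_{n\to\infty}-\frac{\log\mu(B_n(x,\delta))}{n},$$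 where the equality of the two limits for $\mu$-a.e. $x$ (together with $T$-invariance of $h_\mu(T,\cdot)$ and $\int h_\mu(T,x)\,d\mu(x)=h_\mu(T)$) is the classical Brin-Katok formula. The value $+\infty$ is allowed. *)

(* Defs.v *)
From HB Require Import structures.
From mathcomp Require Export all_boot all_order all_algebra.
From mathcomp Require Export all_classical all_reals all_analysis.
Export Order.TTheory GRing.Theory Num.Theory numFieldNormedType.Exports.

Set Implicit Arguments.
Unset Strict Implicit.
Unset Printing Implicit Defensive.

Local Open Scope classical_set_scope.
Local Open Scope ring_scope.

(* The library's generated sigma-algebras need a pointed carrier.  A space that
   carries a probability measure is nonempty, so asking for a base point loses
   no generality; the point is not used below. *)
#[short(type="pointedMetricType")]
HB.structure Definition PointedMetric (K : numDomainType) :=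
  { M of Pointed M & Metric K M }.

Notation borel X := (g_sigma_algebraType (@open X)).

Section Dynamics.
Context {R : realType} {X : pointedMetricType R}.
Implicit Types (T : X -> X) (x y : X) (n : nat) (delta : R).

Definition invariant_measure T (mu : probability (borel X) R) : Prop :=
  forall A : set (borel X), measurable A -> mu (T @^-1` A) = mu A.

(* The match pi is given by its domain D and a total function p on
   {0, ..., n-1}, of which only the restriction to D matters; R(pi) is the
   image of D under p, and strict monotonicity makes p a bijection from D
   onto it. *)
Definition fk_match T n delta x y (D : {set 'I_n}) (p : {ffun 'I_n -> 'I_n})
    : bool :=
  [forall i in D, forall j in D, (i < j)%N ==> (p i < p j)%N] &&
  [forall i in D, mdist (iter i T x) (iter (p i) T y) < delta].

Definition max_match T n delta x y : nat :=
  \max_(Dp : {set 'I_n} * {ffun 'I_n -> 'I_n}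
        | fk_match T delta x y Dp.1 Dp.2) #|Dp.1|.

Definition fbar T n delta x y : R :=
  1 - (max_match T n delta x y)%:R / n%:R.

Definition fk_dist T n x y : R :=
  inf [set delta : R | 0 < delta /\ fbar T n delta x y < delta].

Definition fk_ball T n x delta : set X := [set y | fk_dist T n x y < delta].

(* The distances are nonnegative, so starting the maximum from 0 is harmless. *)
Definition bowen_dist T n x y : R :=
  \big[Num.max/0]_(i < n) mdist (iter i T x) (iter i T y).

Definition bowen_ball T n x delta : set X :=
  [set y | bowen_dist T n x y < delta].

(* [lne] is the extended logarithm, with [lne 0 = -oo]. *)
Definition decay_rate (mu : probability (borel X) R) (A : nat -> set X)
    (n : nat) : \bar R :=
  (- lne (mu (A n)) * (n%:R^-1)%:E)%E.

Definition bowen_lower T mu x delta : \bar R :=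
  limn_einf (decay_rate mu (fun n => bowen_ball T n x delta)).
Definition bowen_upper T mu x delta : \bar R :=
  limn_esup (decay_rate mu (fun n => bowen_ball T n x delta)).

Definition fk_lower T mu x delta : \bar R :=
  limn_einf (decay_rate mu (fun n => fk_ball T n x delta)).
Definition fk_upper T mu x delta : \bar R :=
  limn_esup (decay_rate mu (fun n => fk_ball T n x delta)).

(* h_mu(T, x) = h; the value h is unique when it exists, since \bar R is
   Hausdorff. *)
Definition is_local_entropy T mu x (h : \bar R) : Prop :=
  bowen_lower T mu x delta @[delta --> 0^'+] --> h /\
  bowen_upper T mu x delta @[delta --> 0^'+] --> h.

End Dynamics.

(* Main.v *)
Require Import Defs.
From mathcomp Require Import measurable_realfun zify ring lra.

(** Write B_n(x, d) for the Bowen balls and B_FKn(x, d) for the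
Feldman-Katok balls.  Since B_n(x, d) is contained in B_FKn(x, d), and since
all four rates grow as d decreases to 0, the limits over d exist, and
everything reduces to one inequality: almost everywhere, the upper Bowen rate
is at most the lower Feldman-Katok rate ([ae_bowen_upper_le_fk_lower]).  This
single inequality also contains the almost sure existence of the local entropy.
It follows from covering and counting orbit segments, in the style of Ornstein
and Weiss.

Fix a < b and a radius r.  Let A be the set of points x such that, at every
scale d, infinitely many times n satisfy mu(B_FKn(x, d)) > exp(-a n).  The
claim is that almost no x in A satisfies mu(B_N(x, r)) < exp(-b N) for
infinitely many N ([heavy_light_negligible]).

Counting inside one block.  At a given time n there are at most exp(a n)
disjoint balls of measure above exp(-a n).  Two orbits at small Feldman-Katok
distance agree up to few insertions and deletions.  Hence, for d small
compared with r and e, the points of one such ball have at most exp(e n)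
itineraries at precision r, and the points whose n-ball is heavy have at most
exp((a + e) n) of them ([heavy_codable]).

Counting long orbits.  The set A is forward invariant, so a point of A sees
heavy balls all along its orbit.  Cutting the orbit greedily into heavy blocks
of length between n1 and n2 leaves uncovered only the visits to an exceptional
set F of small measure.  By the maximal ergodic inequality these visits have a
small frequency, outside a set of small measure
([maximal_inequality_infinite]).  Orbits tiled in this way have at most
exp((a + 3 e) N) itineraries up to a constant factor ([tiled_codable]).  If
b = a + 4 e, the points of these orbits whose Bowen N-ball has measure below
exp(-b N) lie in a union of such balls, one for each itinerary; its measure is
at most a constant times exp(-e N), and the Borel-Cantelli lemma concludes.

Both counts avoid binomial coefficients: the number of itineraries obeys a
linear recursion, and one checks that a weight of the form P ^ N * Q ^ k, for
length N and k errors, is a supersolution of it. *)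

Set Implicit Arguments.
Unset Strict Implicit.
Unset Printing Implicit Defensive.

Local Open Scope classical_set_scope.
Local Open Scope ring_scope.

(** * Matching orbits up to insertions and deletions *)

Section EditRelation.
Context {R : realType} {X : pointedMetricType R} (T : X -> X).
Implicit Types (x y z : X) (n m k b : nat) (d e : R).

Lemma open_mdist_lt x d : open [set y | mdist x y < d].
Proof.
rewrite openE => y /= xy; apply/nbhs_ballP.
exists (d - mdist x y) => /=; first by rewrite subr_gt0.
rewrite ballEmdist => z /= yz.
by apply: le_lt_trans (metric_triangle _ y _) _; rewrite -ltrBrDl.
Qed.

(** [edit d n x m y b]: the orbit of x of length n turns into the orbit of y of
length m by deleting and inserting at most b points and moving each remaining
point by less than d.  For n = m the least such b is twice the number of times
missed by the best match; the recursive form makes symmetry, the triangle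
inequality and the counting of orbits plain inductions. *)
Inductive edit d : nat -> X -> nat -> X -> nat -> Prop :=
| edit_nil x y b : edit d 0 x 0 y b
| edit_skipl n x m y b :
    edit d n (T x) m y b -> edit d n.+1 x m y b.+1
| edit_skipr n x m y b :
    edit d n x m (T y) b -> edit d n x m.+1 y b.+1
| edit_match n x m y b :
    mdist x y < d -> edit d n (T x) m (T y) b -> edit d n.+1 x m.+1 y b.

Lemma edit_weaken d e n x m y b c : d <= e -> (b <= c)%N ->
  edit d n x m y b -> edit e n x m y c.
Proof.
move=> de bc h; elim: h c bc => {n x m y b}.
- by move=> *; exact: edit_nil.
- by move=> n x m y b _ ih [//|c] bc; apply: edit_skipl; exact: ih.
- by move=> n x m y b _ ih [//|c] bc; apply: edit_skipr; exact: ih.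
- move=> n x m y b xy _ ih c bc; apply: edit_match; last exact: ih.
  exact: lt_le_trans de.
Qed.

Lemma edit_sym d n x m y b : edit d n x m y b -> edit d m y n x b.
Proof.
elim=> {n x m y b}.
- by move=> *; exact: edit_nil.
- by move=> *; exact: edit_skipr.
- by move=> *; exact: edit_skipl.
- by move=> n x m y b xy _ ih; apply: edit_match => //; rewrite metric_sym.
Qed.

Lemma edit_refl d n x : 0 < d -> edit d n x n x 0.
Proof.
move=> d0; elim: n x => [|n ih] x; first exact: edit_nil.
by apply: edit_match => //; rewrite mdistxx.
Qed.

Lemma edit_skips d i j n x m y b :
  edit d n (iter i T x) m (iter j T y) b ->
  edit d (i + n) x (j + m) y (i + j + b).
Proof.
elim: i x => [|i ihi] x; last first.
  by rewrite !addSn iterSr => /ihi; exact: edit_skipl.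
rewrite !add0n /=; elim: j y => [//|j ihj] y.
by rewrite !addSn iterSr => /ihj; exact: edit_skipr.
Qed.

Lemma edit_drop d n x m y : edit d n x m y (n + m).
Proof.
by have := @edit_skips d n m 0 x 0 y 0 (edit_nil _ _ _ _); rewrite !addn0.
Qed.

(** Triangle inequality.  A point of the middle orbit that is deleted on one
side only must be paid for on the other side, which the sum of the two budgets
covers; a point matched on both sides is moved by less than d + e. *)
Lemma edit_trans d e n x m y k z b c :
  edit d n x m y b -> edit e m y k z c -> edit (d + e) n x k z (b + c).
Proof.
move=> h; elim: h k z c => {n x m y b}.
- move=> x y b k; elim: k => [|k ih] z c h; first exact: edit_nil.
  inversion h; subst; rewrite addnS; apply: edit_skipr; exact: ih.
- by move=> n x m y b _ ih k z c h; rewrite addSn; apply: edit_skipl; exact: ih.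
- move=> n x m y b _ ih; elim=> [|k ihk] z c h; inversion h; subst.
  + by apply: edit_weaken (lexx _) _ (ih _ _ _ ltac:(eassumption)); lia.
  + by apply: edit_weaken (lexx _) _ (ih _ _ _ ltac:(eassumption)); lia.
  + by rewrite addnS; apply: edit_skipr; exact: ihk.
  + by rewrite addSn; apply: edit_skipr; exact: ih.
- move=> n x m y b xy _ ih; elim=> [|k ihk] z c h; inversion h; subst.
  + by rewrite addnS; apply: edit_skipl; exact: ih.
  + by rewrite addnS; apply: edit_skipl; exact: ih.
  + by rewrite addnS; apply: edit_skipr; exact: ihk.
  + apply: edit_match; last exact: ih.
    by apply: (le_lt_trans (metric_triangle _ y _)); exact: ltrD.
Qed.

(** Dropping the first point of the orbit of x and appending one at the end
gives the orbit of T x.  This makes heaviness of balls pass from x to T x. *)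
Lemma edit_shift d n x : 0 < d -> edit d n (T x) n x 2.
Proof.
move=> d0; case: n => [|n]; first exact: edit_nil.
apply: edit_skipr; elim: n x => [|n ih] x.
  by apply: edit_skipl; exact: edit_nil.
by apply: edit_match; [rewrite mdistxx|exact: ih].
Qed.

Lemma edit_nbhs d n x m y b : continuous T -> edit d n x m y b ->
  \forall y' \near y, edit d n x m y' b.
Proof.
move=> cT; elim=> {n x m y b}.
- by move=> x y b; near=> y'; exact: edit_nil.
- by move=> n x m y b _; apply: filterS => y'; exact: edit_skipl.
- move=> n x m y b _ /(cT y) ih.
  have : nbhs y [set y' | edit d n x m (T y') b] := ih.
  by apply: filterS => y'; exact: edit_skipr.
- move=> n x m y b xy _ /(cT y) ih0.
  have ih : nbhs y [set y' | edit d n (T x) m (T y') b] := ih0.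
  have : nbhs y [set y' | mdist x y' < d].
    by apply: open_nbhs_nbhs; split; first exact: open_mdist_lt.
  by move: ih; apply: filterS2 => y' h xy'; apply: edit_match.
Unshelve. all: by end_near. Qed.

(** A match is an increasing list of pairs of times; reading the list from left
to right, everything between two consecutive pairs is skipped.  The equation
on b counts the unmatched points of both orbits. *)
Lemma pairs_edit d N x y (l : seq (nat * nat)) i j :
  (i <= N)%N -> (j <= N)%N ->
  sorted (fun p q => (p.1 < q.1)%N && (p.2 < q.2)%N) l ->
  (forall p, p \in l -> [&& (i <= p.1 < N)%N, (j <= p.2 < N)%N &
    mdist (iter p.1 T x) (iter p.2 T y) < d]) ->
  exists2 b, (b + 2 * size l = (N - i) + (N - j))%N &
    edit d (N - i) (iter i T x) (N - j) (iter j T y) b.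
Proof.
elim: l i j => [|[p q] l ih] i j iN jN /= sl hl.
  exists ((N - i) + (N - j))%N; first by rewrite addn0.
  exact: edit_drop.
have /and3P[/= /andP[ip pN] /andP[jq qN] pq] := hl _ (mem_head _ _).
have [||| |b hb hE] := ih p.+1 q.+1 => //.
- exact: path_sorted sl.
- move=> [p' q'] l'; have /and3P[/= /andP[_ p'N] /andP[_ q'N] pq'] :=
    hl _ (@mem_behead _ (_ :: _) _ l').
  have tr : transitive
    (fun p q : nat * nat => (p.1 < q.1)%N && (p.2 < q.2)%N).
    by move=> ? ? ? /andP[? ?] /andP[? ?]; apply/andP; split; lia.
  have /allP/(_ _ l')/andP[/= ? ?] := order_path_min tr sl.
  by rewrite pq' andbT; apply/andP; split; apply/andP.
exists ((p - i) + (q - j) + b)%N; first by move: hb => /=; lia.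
have -> : (N - i = (p - i) + (N - p.+1).+1)%N by lia.
have -> : (N - j = (q - j) + (N - q.+1).+1)%N by lia.
apply: edit_skips; rewrite -!iterD !subnK//.
exact: edit_match.
Qed.

Lemma fk_match_edit n d x y (D : {set 'I_n}) (p : {ffun 'I_n -> 'I_n}) :
  fk_match T d x y D p -> edit d n x n y (2 * (n - #|D|)).
Proof.
move=> /andP[/forall_inP mono /forall_inP close].
have [||b hb he] := @pairs_edit d n x y
  [seq (val i, val (p i)) | i <- enum D] 0 0 (leq0n _) (leq0n _).
- rewrite sorted_map.
  have : sorted (fun i j : 'I_n => (i < j)%N) (enum D).
    rewrite (_ : enum D = [seq i <- enum 'I_n | i \in D]); last first.
      by rewrite enumT.
    apply: sorted_filter; first by move=> ? ? ?; exact: ltn_trans.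
    by have := iota_ltn_sorted 0 n; rewrite -val_enum_ord sorted_map.
  apply: sub_in_sorted (_ : all [in D] (enum D)); last first.
    by apply/allP => i; rewrite mem_enum.
  move=> i j iD jD /= ij; rewrite ij /=.
  by have /forall_inP/(_ _ jD)/implyP := mono _ iD; apply.
- move=> _ /mapP[i + ->] /=; rewrite mem_enum => iD.
  by rewrite !ltn_ord /= close.
move: hb he; rewrite !subn0 size_map -cardE /= => hb.
by rewrite mulnBr mul2n -addnn -hb addnK.
Qed.

Lemma max_match_attained n d x y : exists D : {set 'I_n},
  exists2 p : {ffun 'I_n -> 'I_n}, fk_match T d x y D p &
    max_match T n d x y = #|D|.
Proof.
pose A := [pred Dp : {set 'I_n} * {ffun 'I_n -> 'I_n} |
  fk_match T d x y Dp.1 Dp.2].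
have [|[D p] hDp e] := @eq_bigmax_cond _ A (fun Dp => #|Dp.1|).
  apply/card_gt0P; exists (finset.set0 : {set 'I_n}, [ffun i => i]); rewrite inE /=.
  by apply/andP; split; apply/forall_inP => i; rewrite inE.
by exists D, p.
Qed.

(** For n = 0 both sides compare 1 with e, because division by 0 gives 0. *)
Lemma fbar_ltP n d x y e : fbar T n d x y < e <->
  exists D : {set 'I_n}, exists2 p : {ffun 'I_n -> 'I_n}, fk_match T d x y D p &
    1 - #|D|%:R / n%:R < e :> R.
Proof.
split=> [|[D [p Dp] h]].
  have [D [p Dp De]] := max_match_attained n d x y.
  by rewrite /fbar De => h; exists D, p.
apply: le_lt_trans h; rewrite /fbar lerD2l lerN2 ler_wpM2r ?invr_ge0//.
pose A := [pred Dp : {set 'I_n} * {ffun 'I_n -> 'I_n} |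
  fk_match T d x y Dp.1 Dp.2].
by rewrite ler_nat; exact: (@leq_bigmax_cond _ A (fun Dp => #|Dp.1|) (D, p)).
Qed.

Lemma fk_ballP n x d y : fk_ball T n x d y <->
  exists2 e, 0 < e < d & fbar T n e x y < e.
Proof.
rewrite /fk_ball /= /fk_dist; set S := (X in inf X).
have hS : has_inf S.
  split; last by exists 0 => e [/ltW].
  exists 2; split => //; apply: (@le_lt_trans _ _ 1); last by rewrite ltr1n.
  by rewrite /fbar gerBl divr_ge0.
split=> [hd|[e /andP[e0 ed] he]].
  have dS : 0 < d - inf S by rewrite subr_gt0.
  have [e [e0 he]] := inf_adherent dS hS.
  by rewrite addrC subrK => ed; exists e => //; rewrite e0.
by apply: le_lt_trans ed; apply: ge_inf => //; case: hS.
Qed.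

Lemma fk_ball_le n x d e : d <= e -> fk_ball T n x d `<=` fk_ball T n x e.
Proof. by move=> de y /= /lt_le_trans; exact. Qed.

Lemma bowen_ballP n x d y : 0 < d -> bowen_ball T n x d y <->
  forall i, (i < n)%N -> mdist (iter i T x) (iter i T y) < d.
Proof.
move=> d0; rewrite /bowen_ball /= /bowen_dist; split => [+ i ni|h].
  apply: le_lt_trans; pose f (i : 'I_n) := mdist (iter i T x) (iter i T y).
  exact: (le_bigmax _ f (Ordinal ni)).
by apply: bigmax_lt => // i _; exact: h.
Qed.

Lemma bowen_ball_le n x d e :
  d <= e -> bowen_ball T n x d `<=` bowen_ball T n x e.
Proof. by move=> de y /= /lt_le_trans; exact. Qed.

(** The identity is a match of full size as soon as its tolerance e exceeds the
Bowen distance.  The infimum in the Feldman-Katok distance needs such an e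
strictly below d, and the midpoint between the two is one. *)
Lemma bowen_ball_sub_fk_ball n x d : (0 < n)%N -> 0 < d ->
  bowen_ball T n x d `<=` fk_ball T n x d.
Proof.
move=> n0 d0 y; rewrite /bowen_ball /= => ltd; apply/fk_ballP.
pose e := Num.max (d / 2) ((bowen_dist T n x y + d) / 2).
have e0 : 0 < e by rewrite lt_max divr_gt0.
exists e; first by rewrite e0 gt_max; apply/andP; split; lra.
apply/fbar_ltP; exists (finset.setTfor 'I_n), [ffun i => i].
  apply/andP; split; apply/forall_inP => i _.
    by apply/forall_inP => j _; rewrite !ffunE; exact/implyP.
  rewrite ffunE; apply: (@le_lt_trans _ _ (bowen_dist T n x y)).
    exact: (le_bigmax _ (fun i : 'I_n => mdist (iter i T x) (iter i T y))).
  by rewrite lt_max; apply/orP; right; lra.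
by rewrite cardsT card_ord divff ?subrr// pnatr_eq0 -lt0n.
Qed.

(** The budget of 2 d n edits corresponds to matches missing less than d n
times, as each missed time costs one deletion and one insertion. *)
Definition edit_ball n x d : set X :=
  [set y | exists2 b, b%:R <= 2 * d * n%:R & edit d n x n y b].

Lemma fk_ball_sub_edit_ball n x d : fk_ball T n x d `<=` edit_ball n x d.
Proof.
move=> y /fk_ballP[e /andP[e0 ed] /fbar_ltP[D [p Dp De]]].
exists (2 * (n - #|D|))%N; last first.
  by apply: edit_weaken (ltW ed) (leqnn _) _; exact: fk_match_edit Dp.
have cD : (#|D| <= n)%N by rewrite -[leqRHS]card_ord max_card.
case: n D p cD Dp De => [|n] D p cD Dp De; first by rewrite mulr0 sub0n.
rewrite natrM -mulrA ler_pM2l// natrB//.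
move: De; rewrite ltrBlDr -ltrBlDl ltr_pdivlMr ?ltr0n//.
have : e * n.+1%:R <= d * n.+1%:R by rewrite ler_wpM2r// ltW.
by rewrite mulrBl mul1r; lra.
Qed.

Lemma edit_ball_center n x d : 0 < d -> edit_ball n x d x.
Proof. by move=> d0; exists 0%N; [rewrite !mulr_ge0// ltW|exact: edit_refl]. Qed.

Lemma edit_ball_sym n x d y : edit_ball n x d y -> edit_ball n y d x.
Proof. by move=> [b hb /edit_sym h]; exists b. Qed.

Lemma edit_ball_trans n x d y e z :
  edit_ball n x d y -> edit_ball n y e z -> edit_ball n x (d + e) z.
Proof.
move=> [b hb hxy] [c hc hyz]; exists (b + c)%N; last exact: edit_trans hxy hyz.
by rewrite natrD; nra.
Qed.

Lemma edit_ball_shift n x d : 0 < d -> 1 <= d * n%:R -> edit_ball n x d (T x).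
Proof.
move=> d0 dn; exists 2%N; first by rewrite -mulrA; lra.
by apply: edit_sym; exact: edit_shift.
Qed.

Lemma edit_ball_le n x d e : d <= e -> edit_ball n x d `<=` edit_ball n x e.
Proof.
move=> de y [b hb h]; exists b; last exact: edit_weaken de (leqnn _) h.
by apply: le_trans hb _; rewrite ler_wpM2r// ler_wpM2l.
Qed.

Section Continuous.
Context (cT : continuous T).

Lemma open_edit_ball n x d : open (edit_ball n x d).
Proof.
rewrite openE => y [b hb h].
by have := edit_nbhs cT h; apply: filterS => y' h'; exists b.
Qed.

Lemma iter_continuous n : continuous (iter n T).
Proof.
elim: n => [|n ih] x; first exact: cvg_id.
by apply: (@continuous_comp _ _ _ (iter n T) T); [exact: ih|exact: cT].
Qed.

Lemma open_iter_ball i x d : open [set y | mdist x (iter i T y) < d].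
Proof.
rewrite (_ : [set _ | _] = iter i T @^-1` [set y | mdist x y < d])//.
by apply: open_comp; [move=> y _; exact: iter_continuous|exact: open_mdist_lt].
Qed.

Lemma open_fk_ball n x d : open (fk_ball T n x d).
Proof.
have -> : fk_ball T n x d = \bigcup_(e in [set e | 0 < e < d])
  \bigcup_(D in [set: {set 'I_n}])
  \bigcup_(p in [set p : {ffun 'I_n -> 'I_n} | 1 - #|D|%:R / n%:R < e])
  [set y | fk_match T e x y D p].
  apply/seteqP; split=> y.
    move=> /fk_ballP[e ed /fbar_ltP[D [p Dp De]]].
    by exists e => //; exists D => //; exists p.
  move=> [e ed [D _ [p De Dp]]]; apply/fk_ballP; exists e => //.
  by apply/fbar_ltP; exists D, p.
apply: bigcup_open => e _; apply: bigcup_open => D _; apply: bigcup_open => p _.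
rewrite openE => y /andP[mono /forall_inP close].
have : \forall y' \near y, forall i, i \in D ->
    mdist (iter i T x) (iter (p i) T y') < e.
  apply: filter_forall => i.
  case: (boolP (i \in D)) => [iD|_]; last by near=> y'.
  have : nbhs y [set y' | mdist (iter i T x) (iter (p i) T y') < e].
    by apply: open_nbhs_nbhs; split; [exact: open_iter_ball|exact: close].
  by apply: filterS.
by apply: filterS => y' h; apply/andP; split => //; apply/forall_inP.
Unshelve. all: by end_near. Qed.

Lemma open_bowen_ball n x d : open (bowen_ball T n x d).
Proof.
rewrite openE => y; rewrite /bowen_ball /= => yd.
have d0 : 0 < d by apply: le_lt_trans yd; exact: bigmax_ge_id.
move/(bowen_ballP _ _ _ d0) : yd => close.
have : \forall y' \near y, forall i : 'I_n,
    mdist (iter i T x) (iter i T y') < d.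
  apply: filter_forall => i; apply: open_nbhs_nbhs.
  split; first exact: open_iter_ball.
  exact: close.
apply: filterS => y' h'; apply/(bowen_ballP _ _ _ d0) => i ni.
exact: (h' (Ordinal ni)).
Qed.
End Continuous.
End EditRelation.

(** * Counting itineraries *)

Section Coding.
Context {R : realType} {X : pointedMetricType R} (T : X -> X).
Implicit Types (x y z : X) (n m k b : nat) (d e r M : R) (S : set X).

(** [codable n r S M]: the orbits of length n issued from S have at most M
itineraries at precision r, in the sense that S splits into at most M pieces
with any two points at Bowen distance less than r.  The bound M is real so that
exponential rates can be used directly. *)
Definition codable n r S M := exists2 m : nat, m%:R <= M &
  exists2 f : X -> nat, (forall x, S x -> (f x < m)%N) &
    forall x y, S x -> S y -> f x = f y ->
      forall i, (i < n)%N -> mdist (iter i T x) (iter i T y) < r.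

Lemma codable_sub n r S M S' M' : codable n r S' M' ->
  S `<=` S' -> M' <= M -> codable n r S M.
Proof.
move=> [m mM [f fm fr]] SS MM; exists m; first exact: le_trans MM.
by exists f => [x /SS/fm//|x y /SS Sx /SS Sy]; exact: fr.
Qed.

Lemma codable0 r S : codable 0 r S 1.
Proof. by exists 1%N => //; exists (fun=> 0%N). Qed.

Lemma codable_set0 n r M : 0 <= M -> codable n r set0 M.
Proof. by move=> M0; exists 0%N => //; exists (fun=> 0%N). Qed.

Lemma codableU n r S M S' M' : codable n r S M -> codable n r S' M' ->
  codable n r (S `|` S') (M + M').
Proof.
move=> [m mM [f fm fr]] [m' mM' [f' fm' fr']].
exists (m + m')%N; first by rewrite natrD lerD.
exists (fun x => if `[< S x >] then f x else (m + f' x)%N).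
  move=> x; case: asboolP => [Sx _|nSx [//|S'x]].
    by rewrite (leq_trans (fm _ Sx))// leq_addr.
  by rewrite ltn_add2l fm'.
move=> x y xS yS; case: asboolP => Sx; case: asboolP => Sy.
- exact: fr.
- by move=> e; have := fm _ Sx; rewrite e ltnNge leq_addr.
- by move=> e; have := fm _ Sy; rewrite -e ltnNge leq_addr.
- case: xS => // S'x; case: yS => // S'y /addnI; exact: fr'.
Qed.

Lemma codable_bigU (I : eqType) n r (s : seq I) (S : I -> set X) (M : I -> R) :
  (forall i, i \in s -> codable n r (S i) (M i)) ->
  codable n r (\bigcup_(i in [set` s]) S i) (\sum_(i <- s) M i).
Proof.
elim: s => [|i s ih] h.
  rewrite big_nil; apply: codable_sub (codable_set0 _ _ (lexx 0)) _ (lexx _).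
  by move=> x [].
rewrite big_cons; apply: codable_sub
  (codableU (h i (mem_head _ _)) (ih _)) _ (lexx _).
  by move=> j js; apply: h; rewrite inE js orbT.
move=> x [j /=]; rewrite inE => /orP[/eqP ->|js] Sx; first by left.
by right; exists j.
Qed.

(** The itinerary of length n + m is the pair of the itinerary of x of length n
and that of [iter n T x] of length m; the pair is encoded as a mixed radix
number. *)
Lemma codable_cat n m r S M S' M' : codable n r S M -> codable m r S' M' ->
  codable (n + m) r (S `&` iter n T @^-1` S') (M * M').
Proof.
move=> [k kM [f fm fr]] [k' kM' [f' fm' fr']].
exists (k * k')%N; first by rewrite natrM ler_pM.
exists (fun x => f x * k' + f' (iter n T x))%N.
  move=> x [/fm fx /fm' f'x]; apply: (@leq_trans (f x * k' + k')%N).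
    by rewrite ltn_add2l.
  by rewrite -mulSnr leq_mul2r fx orbT.
move=> x y [Sx S'x] [Sy S'y] e i inm.
have k0 : (0 < k')%N by apply: leq_ltn_trans (fm' _ S'x).
have /eqP ef : f x == f y.
  apply/eqP; have := congr1 (divn^~ k') e.
  by rewrite !divnMDl// !divn_small ?addn0//; exact: fm'.
have ef' : f' (iter n T x) = f' (iter n T y) by move: e; rewrite ef => /addnI.
have [ni|ni] := ltnP i n; first exact: fr.
have := fr' _ _ S'x S'y ef' (i - n)%N; rewrite -!iterD subnK//.
by apply; rewrite ltn_subLR.
Qed.

Lemma codable_ball p d r : 2 * d <= r -> codable 1 r [set y | mdist p y < d] 1.
Proof.
move=> dr; exists 1%N => //; exists (fun=> 0%N) => // x y /= px py _ [|//] _.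
apply: lt_le_trans dr; rewrite mulr2n mulrDl mul1r.
by apply: (le_lt_trans (metric_triangle _ p _)); rewrite ltrD// metric_sym.
Qed.

Lemma compact_codable r : compact [set: X] -> 0 < r ->
  exists2 K : R, 0 <= K & codable 1 r setT K.
Proof.
rewrite compact_cover => cX r0.
have [||D _ hD] := cX X setT (fun p => [set y | mdist p y < r / 2]).
- by move=> p _; exact: open_mdist_lt.
- by move=> x _; exists x => //=; rewrite mdistxx divr_gt0.
pose s := finmap.enum_fset D; pose near x p := mdist p x < r / 2.
have hs x : has (near x) s.
  by have [p pD px] := hD x I; apply/hasP; exists p.
exists (size s)%:R => //; exists (size s) => //.
exists (fun x => find (near x) s).
  by move=> x _; rewrite -has_find.
move=> x y _ _ e [|//] _ /=.
have /= := nth_find point (hs x); have /= := nth_find point (hs y).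
rewrite -e /near; set p := nth _ _ _ => py px.
rewrite (splitr r); apply: (le_lt_trans (metric_triangle _ p _)).
by rewrite ltrD// metric_sym.
Qed.

(** Only deleted or inserted points carry information about y, since a matched
point lies within d of a known point.  The number w(n, m, b) of itineraries
thus satisfies
  w(n, m, b) <= w(n-1, m, b-1) + K w(n, m-1, b-1) + w(n-1, m-1, b),
and the assumption on q and Q says that q ^ (n + m) * Q ^ b is a supersolution
of this recursion.  Since q can be taken as close to 1 as desired, at the price
of a large Q, small budgets b yield a small exponential rate. *)
Lemma edit_codable d r (K q Q : R) n x m b :
  codable 1 r setT K -> 0 <= K -> 2 * d <= r -> 1 <= q -> 1 <= Q ->
  (1 + K) * q + Q <= q ^+ 2 * Q ->
  codable m r [set y | edit T d n x m y b] (q ^+ (n + m) * Q ^+ b).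
Proof.
move=> hK K0 dr q1 Q1 hqQ; pose w n m b := q ^+ (n + m) * Q ^+ b.
have q0 : 0 <= q by apply: le_trans q1.
have Q0 : 0 <= Q by apply: le_trans Q1.
have w1 n' m' c : 1 <= w n' m' c by rewrite -[leLHS]mulr1 ler_pM ?exprn_ege1.
rewrite -/(w n m b); elim: n x m b => [|n ihn] x; elim=> [|m ihm] b.
- exact: codable_sub (codable0 r setT) (@subsetT _ _) (w1 _ _ _).
- case: b => [|b].
    apply: codable_sub (codable_set0 _ _ (lexx 0)) _ _; last first.
      by apply: le_trans (w1 _ _ _).
    by move=> y /= h; inversion h.
  apply: codable_sub (codable_cat hK (ihm b)) _ _.
    by move=> y /= h; inversion h.
  rewrite /w addnS exprS [Q ^+ b.+1]exprS mulrACA ler_wpM2r ?mulr_ge0 ?exprn_ge0//.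
  by nra.
- exact: codable_sub (codable0 r setT) (@subsetT _ _) (w1 _ _ _).
- have hball := codable_cat (codable_ball x dr) (ihn (T x) m b).
  rewrite add1n mul1r in hball.
  case: b hball => [|b] hball.
    apply: codable_sub hball _ _; last first.
      rewrite /w ler_wpM2r ?exprn_ge0// ler_weXn2l//; lia.
    by move=> y /= h; inversion h.
  have h1 := ihn (T x) m.+1 b.
  have h2 := codable_cat hK (ihm b); rewrite add1n in h2.
  apply: codable_sub (codableU h1 (codableU h2 hball)) _ _.
    move=> y /= h; inversion h; subst; first by left.
      by right; left.
    by right; right.
  rewrite /w !addnS !addSn !exprS.
  set u := q ^+ _; set v := Q ^+ _.
  have uv : 0 <= u * v by rewrite mulr_ge0 ?exprn_ge0.
  by nra.
Qed.

Definition visits (F : set X) n x : nat := \sum_(i < n) `[< F (iter i T x) >].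

Lemma visitsD F n m x :
  visits F (n + m) x = (visits F n x + visits F m (iter n T x))%N.
Proof.
rewrite /visits big_split_ord; congr (_ + _)%N.
by apply: eq_bigr => i _; rewrite /= -iterD addnC.
Qed.

Lemma visits1 F x : visits F 1 x = `[< F x >].
Proof. by rewrite /visits big_ord1. Qed.

Lemma visits_le F n x : (visits F n x <= n)%N.
Proof.
rewrite -[leqRHS]card_ord -sum1_card; apply: leq_sum => i _.
by case: asbool.
Qed.

Section Tiling.
Context (O : nat -> set X) (n1 n2 : nat).

(** [tiled N b x]: the first N times along the orbit of x split into at most b
isolated times and disjoint blocks [i, i + n) with n1 <= n <= n2 such that
[iter i T x] belongs to O n. *)
Inductive tiled : nat -> nat -> X -> Prop :=
| tiled_nil b x : tiled 0 b x
| tiled_skip N b x : tiled N b (T x) -> tiled N.+1 b.+1 x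
| tiled_block n N b x : (n1 <= n <= n2)%N -> O n x ->
    tiled N b (iter n T x) -> tiled (n + N) b x.

Lemma tiled_weaken N b c x : (b <= c)%N -> tiled N b x -> tiled N c x.
Proof.
move=> bc h; elim: h c bc => {N b x}.
- by move=> *; exact: tiled_nil.
- by move=> N b x _ ih [//|c] bc; apply: tiled_skip; exact: ih.
- by move=> n N b x nn On _ ih c bc; apply: tiled_block => //; exact: ih.
Qed.

Lemma tiled_all_skipped N x : tiled N N x.
Proof.
by elim: N x => [|N ih] x; [exact: tiled_nil|apply: tiled_skip; exact: ih].
Qed.

(** From left to right, skip a time when the orbit is in F and otherwise jump
over a block.  Only a last block overflowing time N spoils this; its at most n2
times are skipped instead. *)
Lemma greedy_tiling (F : set X) N x : (0 < n1)%N ->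
  (forall i, ~ F (iter i T x) ->
    exists2 n, (n1 <= n <= n2)%N & O n (iter i T x)) ->
  tiled N (visits F N x + n2) x.
Proof.
move=> n10; elim/ltn_ind: N x => -[|N] ih x hF; first exact: tiled_nil.
have [Fx|nFx] := pselect (F x).
  rewrite -add1n visitsD visits1 asboolT// -addnA !add1n; apply: tiled_skip.
  by apply: ih => // i; rewrite -iterSr; exact: hF.
have [n /andP[n1n nn2] On] := hF 0%N nFx.
have [nN|nN] := leqP n N.+1; last first.
  by apply: tiled_weaken (tiled_all_skipped _ x); lia.
rewrite -[N.+1](subnKC nN) visitsD; apply: tiled_block => //; first by rewrite n1n.
apply: tiled_weaken (ih _ _ _ _); [|lia|]; last first.
  by move=> i; rewrite -iterD; exact: hF.
by rewrite leq_add2r leq_addl.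
Qed.

(** Conditioning on the first time or the first block, the number w(N, b) of
itineraries satisfies
  w(N, b) <= K w(N-1, b-1) + sum over n of C ^ n w(N-n, b),
and the two numerical assumptions give each of the two terms half of
P ^ N * Q ^ b.  The second one holds for any C < P once the blocks are long
enough, so the positions of the blocks cost nothing at exponential scale. *)
Lemma tiled_codable r (K C P Q : R) N b :
  codable 1 r setT K -> 0 <= K -> 0 <= C -> 1 <= P -> 1 <= Q ->
  (0 < n1)%N ->
  (forall n, (n1 <= n <= n2)%N -> codable n r (O n) (C ^+ n)) ->
  2 * K <= P * Q -> \sum_(n1 <= n < n2.+1) (C / P) ^+ n <= 1 / 2 ->
  codable N r [set x | tiled N b x] (P ^+ N * Q ^+ b).
Proof.
move=> hK K0 C0 P1 Q1 n10 hO hKPQ hCP; pose w N b := P ^+ N * Q ^+ b.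
have P0 : 0 < P by apply: lt_le_trans P1.
have Q0 : 0 < Q by apply: lt_le_trans Q1.
have w0 N' c : 0 <= w N' c by rewrite mulr_ge0 ?exprn_ge0// ltW.
have w1 N' c : 1 <= w N' c by rewrite -[leLHS]mulr1 ler_pM ?exprn_ege1.
rewrite -/(w N b); elim/ltn_ind: N b => -[|N] ih b.
  exact: codable_sub (codable0 r setT) (@subsetT _ _) (w1 _ _).
have hskip : codable N.+1 r
    (if b is c.+1 then T @^-1` [set x | tiled N c x] else set0) (w N.+1 b / 2).
  case: b => [|b]; first by apply: codable_set0; rewrite divr_ge0.
  have := codable_cat hK (ih N (ltnSn _) b); rewrite add1n setTI.
  move=> h; apply: codable_sub h _ _ => //; rewrite /w !exprS.
  have := w0 N b; rewrite /w; set u := P ^+ _; set v := Q ^+ _ => uv.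
  have : 2 * K * (u * v) <= P * Q * (u * v) by rewrite ler_wpM2r.
  by lra.
have hblocks : codable N.+1 r (\bigcup_(n in [set` index_iota n1 n2.+1])
    (if (n <= N.+1)%N then O n `&` iter n T @^-1` [set x | tiled (N.+1 - n) b x]
     else set0)) (\sum_(n1 <= n < n2.+1) w N.+1 b * (C / P) ^+ n).
  apply: codable_bigU => n; rewrite mem_index_iota ltnS => nn.
  have CPn : 0 <= w N.+1 b * (C / P) ^+ n.
    by rewrite mulr_ge0// exprn_ge0// divr_ge0// ltW.
  case: ifPn => nN; last exact: codable_set0.
  have := codable_cat (hO _ nn) (ih (N.+1 - n)%N (ltac:(lia)) b).
  rewrite subnKC//; move=> h; apply: codable_sub h _ _ => //.
  rewrite /w -[in leRHS](subnKC nN) exprD expr_div_n.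
  have Pn0 : P ^+ n != 0 by rewrite gt_eqF// exprn_gt0.
  rewrite le_eqVlt; apply/orP; left; apply/eqP; by field.
apply: codable_sub (codableU hskip hblocks) _ _; last first.
  rewrite -mulr_sumr; have := w0 N.+1 b; set v := w _ _ => v0.
  by have := ler_wpM2l v0 hCP; lra.
move=> x /= h; inversion h; subst; first by left.
right; exists n; first by rewrite /= mem_index_iota ltnS.
by rewrite leq_addr addKn; split.
Qed.

End Tiling.
End Coding.

(** * The maximal ergodic inequality *)

Section MaximalInequality.
Context {R : realType} {X : pointedMetricType R} (T : X -> X)
  (mu : probability (borel X) R).
Context (cT : continuous T) (invT : invariant_measure T mu).
Implicit Types (x y z : X) (n m k N M L : nat) (d e r : R).
Implicit Types A E F : set (borel X).

Lemma open_borel (A : set (borel X)) : open (A : set X) -> measurable A.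
Proof. by move=> oA; exact: sub_sigma_algebra. Qed.

Lemma continuous_borel (f : X -> X) A : continuous f -> measurable A ->
  measurable (f @^-1` A : set (borel X)).
Proof.
move=> cf mA.
have : measurable_fun [set: borel X] (f : borel X -> borel X).
  apply: (@measurability _ _ (borel X) (borel X) _ f (@open X)) => // _ [B oB <-].
  rewrite setTI; apply: open_borel; apply: open_comp oB.
  by move=> y _; exact: cf.
by move=> /(_ measurableT A mA); rewrite setTI.
Qed.

Lemma invariant_iter n A : measurable A -> mu (iter n T @^-1` A) = mu A.
Proof.
move=> mA; elim: n => [//|n <-].
rewrite -[RHS]invT; last first.
  by apply: continuous_borel mA; exact: iter_continuous.
by congr (mu _); apply/seteqP; split => x /=; rewrite -iterS iterSr.
Qed.

(** Each time spent in E starts a block of length at most M in which the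
frequency of F is at least g; disjoint such blocks, chosen greedily, cover all
visits to E before time L and end before time L + M. *)
Lemma visits_covering (E F : set X) M (g : R) L x : 0 <= g ->
  (forall y, E y ->
    exists2 N, (0 < N <= M)%N & g * N%:R <= (visits T F N y)%:R) ->
  g * (visits T E L x)%:R <= (visits T F (L + M) x)%:R.
Proof.
move=> g0 hE; elim/ltn_ind: L x => -[|L] ih x.
  by rewrite /visits big_ord0 mulr0.
have [/hE[N /andP[N0 NM] hN]|nEx] := pselect (E x); last first.
  rewrite -[L.+1]add1n -addnA (visitsD _ E) (visitsD _ F).
  rewrite (visits1 _ E) (asboolF nEx).
  apply: le_trans (ih L _ (T x)) _; rewrite //.
  by rewrite ler_nat leq_addl.
have [NL|NL] := leqP N L.+1.
  rewrite -[L.+1](subnKC NL) -addnA (visitsD _ E) (visitsD _ F).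
  rewrite !natrD mulrDr lerD//.
    apply: le_trans hN; rewrite ler_wpM2l// ler_nat; exact: visits_le.
  by apply: ih; lia.
apply: (@le_trans _ _ (g * N%:R)).
  rewrite ler_wpM2l// ler_nat (leq_trans (visits_le _ _ _ _))//; exact: ltnW.
apply: le_trans hN _; rewrite ler_nat -(@subnKC N (L.+1 + M)%N).
  by rewrite visitsD leq_addr.
by lia.
Qed.

Lemma visits_indic (F : set X) n x :
  (visits T F n x)%:R = \sum_(i < n) \1_F (iter i T x) :> R.
Proof.
rewrite /visits natr_sum; apply: eq_bigr => i _.
by rewrite indicE.
Qed.

Lemma measurable_indic_iter F i : measurable F ->
  measurable_fun [set: borel X] (fun x => \1_F (iter i T x) : R).
Proof.
move=> mF; rewrite (_ : (fun x => _) = \1_(iter i T @^-1` F))//.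
apply: measurable_indic; apply: continuous_borel mF; exact: iter_continuous.
Qed.

Lemma measurable_visits F n : measurable F ->
  measurable_fun [set: borel X] (fun x : borel X => (visits T F n x)%:R : R).
Proof.
move=> mF; under eq_fun do rewrite visits_indic.
by apply: measurable_sum => i; exact: measurable_indic_iter.
Qed.

Lemma integral_visits F n : measurable F ->
  (\int[mu]_x ((visits T F n x)%:R)%:E = n%:R%:E * mu F)%E.
Proof.
move=> mF.
under eq_integral do rewrite visits_indic -sumEFin.
rewrite ge0_integral_sum//; last first.
  by move=> i; apply/measurable_EFinP; exact: measurable_indic_iter.
rewrite (eq_bigr (fun=> mu F)); last first.
  move=> i _; have mi : measurable (iter i T @^-1` F : set (borel X)).
    by apply: continuous_borel mF; exact: iter_continuous.
  by rewrite -(invariant_iter i mF) -[X in _ = mu X]setIT -integral_indic.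
by rewrite sumr_const card_ord mule_natl.
Qed.

Definition often_visits (F : set X) (g : R) M : set X :=
  [set x | exists2 N, (0 < N <= M)%N & g * N%:R < (visits T F N x)%:R].

Lemma measurable_often_visits F g M : measurable F ->
  measurable (often_visits F g M : set (borel X)).
Proof.
move=> mF.
rewrite (_ : often_visits _ _ _ = \bigcup_(N in [set N | (0 < N <= M)%N])
  [set x : borel X | g * N%:R < (visits T F N x)%:R]); last first.
  by apply/seteqP; split => x [N]; exists N.
apply: bigcup_measurable => N _.
have := measurable_visits N mF => /(_ measurableT `]g * N%:R, +oo[%classic).
rewrite setTI => h; rewrite (_ : [set x | _] =
  (fun x : borel X => (visits T F N x)%:R : R) @^-1` `]g * N%:R, +oo[%classic).
  by apply: h; exact: measurable_itv.
by apply/seteqP; split => x /=; rewrite in_itv /= andbT.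
Qed.

(** Integrating [visits_covering] gives g L mu(E) <= (L + M) mu(F) by invariance
of mu.  Dividing by L and letting L grow yields the claim. *)
Lemma maximal_inequality F (g : R) M : measurable F -> 0 < g ->
  (g%:E * mu (often_visits F g M) <= mu F)%E.
Proof.
move=> mF g0; set E := often_visits F g M.
have mE : measurable (E : set (borel X)) := measurable_often_visits g M mF.
have key L : g * (L%:R * fine (mu E)) <= (L + M)%:R * fine (mu F).
  rewrite -lee_fin !EFinM !fineK ?fin_num_measure//.
  rewrite -integral_visits// -integral_visits//.
  rewrite -ge0_integralZl//.
  - apply: ge0_le_integral => //.
    + by move=> x _; rewrite mule_ge0// lee_fin// ltW.
    + by apply: measurable_funeM; apply/measurable_EFinP; exact: measurable_visits.
    + by apply/measurable_EFinP; exact: measurable_visits.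
    + move=> x _; rewrite -EFinM lee_fin; apply: visits_covering; first exact: ltW.
      by move=> y [N NM /ltW]; exists N.
  - by apply/measurable_EFinP; exact: measurable_visits.
  - by rewrite lee_fin ltW.
rewrite -[mu E]fineK ?fin_num_measure// -[mu F]fineK ?fin_num_measure//.
rewrite -EFinM lee_fin leNgt; apply/negP => h.
pose D := g * fine (mu E) - fine (mu F).
have D0 : 0 < D by rewrite subr_gt0.
have := key (Num.truncn (M%:R * fine (mu F) / D)).+1.
set L := _.+1; have : M%:R * fine (mu F) / D < L%:R.
  by rewrite real_truncnS_gt ?num_real.
by rewrite ltr_pdivrMr// natrD /D; nra.
Qed.

Lemma maximal_inequality_infinite F (g : R) : measurable F -> 0 < g ->
  exists2 E : set (borel X), measurable E &
    (g%:E * mu E <= mu F)%E /\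
    forall x, ~ E x -> forall N, (visits T F N x)%:R <= g * N%:R.
Proof.
move=> mF g0; exists (\bigcup_M often_visits F g M).
  by apply: bigcup_measurable => M _; exact: measurable_often_visits.
split.
  have : (g%:E * mu (often_visits F g M))%E @[M --> \oo] -->
      (g%:E * mu (\bigcup_M often_visits F g M))%E.
    apply: cvgeZl => //; apply: nondecreasing_cvg_mu.
    - by move=> M; exact: measurable_often_visits.
    - by apply: bigcup_measurable => M _; exact: measurable_often_visits.
    - move=> M M' MM'; apply/subsetPset => x [N /andP[N0 NM] h].
      by exists N => //; rewrite N0 (leq_trans NM).
  move=> h; rewrite -(cvg_lim _ h)//; apply: lime_le.
    by apply/cvg_ex; eexists; exact: h.
  by near=> M; exact: maximal_inequality.
move=> x nE N; rewrite leNgt; apply/negP => h; apply: nE.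
exists N => //; exists N => //; rewrite leqnn andbT lt0n; apply/negP => /eqP N0.
by move: h; rewrite N0 /visits big_ord0 mulr0 ltxx.
Unshelve. all: by end_near. Qed.

End MaximalInequality.

(** * Points with heavy balls *)

Section Heavy.
Context {R : realType} {X : pointedMetricType R} (T : X -> X)
  (mu : probability (borel X) R).
Context (cT : continuous T).
Implicit Types (x y z : X) (n m k N M L : nat) (d e r : R).

Lemma disjoint_family_size (B : X -> set (borel X)) (c : R) (s : seq X) :
  (forall x, measurable (B x)) -> (forall x, x \in s -> (c%:E <= mu (B x))%E) ->
  pairwise (fun x y => `[< B x `&` B y = set0 >]) s -> (size s)%:R * c <= 1.
Proof.
move=> mB hs ps.
suff : (((size s)%:R * c)%:E <= mu (\bigcup_(x in [set` s]) B x))%E.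
  move=> h; rewrite -lee_fin; apply: (le_trans h); apply: probability_le1.
  exact: fin_bigcup_measurable.
elim: s hs ps => [|x s ih] hs /=; first by rewrite mul0r measure_ge0.
move=> /andP[/allP xs ps].
have -> : \bigcup_(y in [set` x :: s]) B y = B x `|` \bigcup_(y in [set` s]) B y.
  apply/seteqP; split => z.
    by move=> [y /=]; rewrite inE => /orP[/eqP ->|ys] yz; [left|right; exists y].
  move=> [xz|[y /= ys yz]]; first by exists x => //=; rewrite mem_head.
  by exists y => //=; rewrite inE ys orbT.
rewrite measureU//; last 2 first.
- exact: fin_bigcup_measurable.
- apply/seteqP; split => z //= -[xz [y ys yz]].
  by have /asboolP/seteqP[+ _] := xs _ ys; apply; split; [exact: xz|exact: yz].
rewrite -natr1 mulrDl mul1r EFinD addeC leeD//.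
  by apply: hs; rewrite mem_head.
by apply: ih => // y ys; apply: hs; rewrite inE ys orbT.
Qed.

(** A disjoint family of sets of measure more than c has at most 1 / c members,
so one of maximal size exists, and every further such set meets it. *)
Lemma maximal_disjoint_family (B : X -> set (borel X)) (c : R) :
  0 < c -> (forall x, measurable (B x)) ->
  exists2 s : seq X, (size s)%:R * c <= 1 &
    forall x, (c%:E < mu (B x))%E ->
    exists2 p, p \in s & exists2 y, B x y & B p y.
Proof.
move=> c0 mB.
pose P k := `[< exists s : seq X, [/\ size s = k,
  forall x, x \in s -> (c%:E <= mu (B x))%E &
  pairwise (fun x y => `[< B x `&` B y = set0 >]) s] >].
have P0 : exists k, P k by exists 0%N; apply/asboolP; exists [::].
have Ple k : P k -> (k <= Num.truncn c^-1)%N.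
  move=> /asboolP[s [<- hs ps]]; rewrite truncn_ge_nat ?invr_ge0 ?(ltW c0)//.
  by rewrite -div1r ler_pdivlMr// (disjoint_family_size mB hs ps).
have [k /asboolP[s [<- hs ps]] kmax] := ex_maxnP P0 Ple.
exists s; first exact: disjoint_family_size mB hs ps.
move=> x cx; apply: contrapT => nmeet.
have : P (size (x :: s)).
  apply/asboolP; exists (x :: s); split => //.
    by move=> y; rewrite inE => /orP[/eqP ->|]; [exact: ltW|exact: hs].
  rewrite /= ps andbT; apply/allP => p ps'; apply/asboolP.
  by apply/seteqP; split => // y [xy py]; apply: nmeet; exists p => //; exists y.
by move/kmax; rewrite /= ltnn.
Qed.

(** The union of the heavy balls, rather than the set of their centres: this is
open, hence measurable, without any study of how the measure of a ball depends
on its centre.  The cost is a constant factor on the radius. *)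
Definition heavy (a : R) d n : set X :=
  \bigcup_(x in [set x | ((expR (- a * n%:R))%:E < mu (edit_ball T n x d))%E])
    edit_ball T n x d.

Lemma open_heavy a d n : open (heavy a d n).
Proof. by apply: bigcup_open => x _; exact: open_edit_ball. Qed.

Lemma measurable_edit_ball n x d :
  measurable (edit_ball T n x d : set (borel X)).
Proof. by apply: open_borel; exact: open_edit_ball. Qed.

Lemma exists_edit_weight (K q : R) : 0 <= K -> 1 < q ->
  exists2 Q : R, 1 <= Q & (1 + K) * q + Q <= q ^+ 2 * Q.
Proof.
move=> K0 q1; have q2 : 0 < q ^+ 2 - 1 by rewrite subr_gt0 exprn_egt1.
exists (1 + (1 + K) * q / (q ^+ 2 - 1)).
  rewrite lerDl; apply: divr_ge0; last exact: ltW.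
  by apply: mulr_ge0; lra.
have : (1 + K) * q / (q ^+ 2 - 1) * (q ^+ 2 - 1) = (1 + K) * q.
  by rewrite divfK// gt_eqF.
by set u := _ / _; lra.
Qed.

(** The heavy balls of a maximal disjoint family number at most exp(a n), and
the concentric balls of radius 3 d cover all heavy balls.  Each of these balls
has at most exp(e n) itineraries by [edit_codable], with q = exp(e / 4) and
then d so small that Q ^ (6 d n) is at most exp(e n / 2). *)
Lemma heavy_codable (a e r : R) : compact [set: X] -> 0 < e -> 0 < r ->
  exists2 d0, 0 < d0 & forall d, 0 < d <= d0 -> forall n,
    codable T n r (heavy a d n) (expR (a + e) ^+ n).
Proof.
move=> cX e0 r0.
have [K K0 hK] := compact_codable T cX r0.
have q1 : 1 < expR (e / 4) by rewrite expR_gt1 divr_gt0.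
have [Q Q1 hQ] := exists_edit_weight K0 q1.
have Q0 : 0 < Q by apply: lt_le_trans Q1.
have lnQ0 : 0 <= ln Q by rewrite ln_ge0.
exists (Num.min (r / 6) (e / (12 * (ln Q + 1)))).
  by rewrite lt_min !divr_gt0// mulr_gt0// ltr_wpDl.
move=> d /andP[d0]; rewrite le_min ler_pdivlMr// ler_pdivlMr; last first.
  by rewrite mulr_gt0// ltr_wpDl.
move=> /andP[dr de] n.
have mB x := measurable_edit_ball n x d.
have [s hs hmeet] := maximal_disjoint_family (expR_gt0 (- a * n%:R)) mB.
pose b := Num.truncn (6 * d * n%:R).
have b_le : b%:R <= 6 * d * n%:R by rewrite truncn_le !mulr_ge0// ltW.
have cod x : codable T n r [set y | edit T (3 * d) n x n y b]
    (expR (e / 4) ^+ (n + n) * Q ^+ b).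
  by apply: edit_codable hQ => //; [lra|exact: ltW].
apply: codable_sub (codable_bigU (s := s) (fun x _ => cod x)) _ _.
  move=> y [x /= /hmeet[p ps [z xz pz]] xy]; exists p => //.
  have [c hc h] : edit_ball T n p (d + d + d) y.
    exact: edit_ball_trans (edit_ball_trans pz (edit_ball_sym xz)) xy.
  apply: edit_weaken h; first by lra.
  by rewrite truncn_ge_nat ?mulr_ge0 ?(ltW d0)//; apply: le_trans hc _; lra.
rewrite big_const_seq count_predT iter_addr_0 -[X in X <= _]mulr_natl.
have size_le : (size s)%:R <= expR (a * n%:R).
  by move: hs; rewrite mulNr expRN ler_pdivrMr ?expR_gt0// mul1r.
have -> : expR (a + e) ^+ n =
    expR (a * n%:R) * (expR (e / 4) ^+ (n + n) * expR (e / 2 * n%:R)).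
  rewrite -!expRM_natr -!expRD natrD; congr expR; by field.
apply: ler_pM => //; first by rewrite mulr_ge0// exprn_ge0 ?expR_ge0// ltW.
rewrite ler_wpM2l ?exprn_ge0 ?expR_ge0//.
rewrite -{1}(@lnK _ Q) ?posrE// -expRM_natr ler_expR.
apply: (@le_trans _ _ (ln Q * (6 * d * n%:R))); first by rewrite ler_wpM2l.
rewrite !mulrA ler_wpM2r//; nra.
Qed.

End Heavy.

(** * Orbits with recurrently heavy Feldman-Katok balls and light Bowen balls *)

Section NullSet.
Context {R : realType} {X : pointedMetricType R} (T : X -> X)
  (mu : probability (borel X) R).
Context (cX : compact [set: X]) (cT : continuous T)
  (invT : invariant_measure T mu).
Implicit Types (x y z : X) (n m k N M L : nat) (a b d e r : R).

Lemma geometric_sum_le (rho : R) n m : 0 <= rho <= 1 ->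
  (1 - rho) * \sum_(n <= i < m) rho ^+ i <= rho ^+ n.
Proof.
move=> /andP[rho0 rho1].
have [nm|mn] := leqP n m; last by rewrite big_geq ?(ltnW mn)// mulr0 exprn_ge0.
suff -> : (1 - rho) * \sum_(n <= i < m) rho ^+ i = rho ^+ n - rho ^+ m.
  by rewrite gerBl exprn_ge0.
rewrite -(subnKC nm); elim: (m - n)%N => [|k ih].
  by rewrite addn0 big_geq// mulr0 subrr.
by rewrite addnS big_nat_recr ?leq_addr//= mulrDr ih exprS; ring.
Qed.

Lemma geometric_tail_le (rho : R) : 0 <= rho < 1 ->
  exists2 n, (0 < n)%N & forall m, \sum_(n <= i < m) rho ^+ i <= 1 / 2.
Proof.
move=> /andP[rho0 rho1].
have : \forall n \near \oo, rho ^+ n < (1 - rho) / 2.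
  have : rho ^+ n @[n --> \oo] --> (0 : R) by apply: cvg_expr; rewrite ger0_norm.
  by move/cvgr_lt; apply; rewrite divr_gt0// subr_gt0.
move=> [n _ hn]; exists n.+1 => // m.
have h := hn n.+1 (leqnSn n); rewrite /= in h.
have rho01 : 0 <= rho <= 1 by rewrite rho0 ltW.
have := geometric_sum_le n.+1 m rho01.
have : 0 < 1 - rho by rewrite subr_gt0.
by move: h; set u := rho ^+ _; set v := \sum_(_ <= _ < _) _; nra.
Qed.

(** Being heavy infinitely often is required at every scale because passing
from x to T x doubles the radius; the requirement at all scales is exactly
forward invariant. *)
Definition recurrently_heavy a : set X :=
  \bigcap_k lim_sup_set (heavy T mu a k.+1%:R^-1).

Lemma measurable_heavy a d n : measurable (heavy T mu a d n : set (borel X)).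
Proof. by apply: open_borel; exact: open_heavy. Qed.

Lemma measurable_recurrently_heavy a :
  measurable (recurrently_heavy a : set (borel X)).
Proof.
apply: bigcapT_measurable => k; apply: bigcapT_measurable => n.
by apply: bigcup_measurable => j _; exact: measurable_heavy.
Qed.

Lemma heavy_shift a d n x : 0 < d -> 1 <= d * n%:R ->
  heavy T mu a d n x -> heavy T mu a (2 * d) n (T x).
Proof.
move=> d0 dn [p /= hp px]; have d2 : d <= 2 * d by lra.
exists p => /=.
  apply: lt_le_trans hp _; apply: le_measure.
  - by rewrite inE; exact: measurable_edit_ball.
  - by rewrite inE; exact: measurable_edit_ball.
  - exact: edit_ball_le.
rewrite mulr2n mulrDl mul1r.
by apply: edit_ball_trans px _; exact: edit_ball_shift.
Qed.

Lemma recurrently_heavy_shift a x :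
  recurrently_heavy a x -> recurrently_heavy a (T x).
Proof.
move=> h k _ n _.
(* The scale 1 / (2 k + 2) is half of 1 / (k + 1), and the shift costs at
   most this scale once the time is at least 2 k + 2. *)
have [j /= jn] := h k.*2.+1 I (maxn n (k.*2.+2)) I.
set d := _^-1 => hj; exists j => /=; first by apply: leq_trans jn; exact: leq_maxl.
have d2 : 2 * d = k.+1%:R^-1.
  by rewrite /d -doubleS -muln2 natrM invfM mulrCA mulfV ?mulr1// mulrC.
rewrite -d2; apply: heavy_shift => //.
  by rewrite /d invr_gt0.
rewrite /d mulrC ler_pdivlMr// mul1r ler_nat.
by apply: leq_trans jn; exact: leq_maxr.
Qed.

Lemma recurrently_heavy_iter a i x :
  recurrently_heavy a x -> recurrently_heavy a (iter i T x).
Proof. by move=> h; elim: i => //= i ih; exact: recurrently_heavy_shift. Qed.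

(** These sets decrease to the empty set as n2 grows, because each point of
[recurrently_heavy a] is heavy at some time after n1. *)
Lemma small_exceptional_set a k n1 (e : R) : 0 < e ->
  exists n2, (mu (recurrently_heavy a `\`
    \bigcup_(n in [set n | (n1 <= n <= n2)%N]) heavy T mu a k.+1%:R^-1 n) <= e%:E)%E.
Proof.
move=> e0; pose F n2 : set (borel X) := recurrently_heavy a `\`
    \bigcup_(n in [set n | (n1 <= n <= n2)%N]) heavy T mu a k.+1%:R^-1 n.
have mF n2 : measurable (F n2).
  apply: measurableD; first exact: measurable_recurrently_heavy.
  by apply: bigcup_measurable => n _; exact: measurable_heavy.
have F0 : \bigcap_n F n = set0.
  apply/seteqP; split => // x Fx.
  have [Ax _] := Fx 0%N I.
  have [j /= jn hj] := Ax k I n1 I.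
  by have [_] := Fx j I; apply; exists j => //=; rewrite jn leqnn.
have : mu (F n) @[n --> \oo] --> mu (\bigcap_n F n).
  apply: nonincreasing_cvg_mu => //.
  - by rewrite (le_lt_trans (probability_le1 _ _))// ltry.
  - exact: bigcapT_measurable.
  - move=> n m nm; apply/subsetPset => x [Ax nh]; split => // -[j /= /andP[nj jn] hj].
    by apply: nh; exists j => //=; rewrite nj (leq_trans jn).
rewrite F0 measure0 => h.
have : \forall n \near \oo, (mu (F n) < e%:E)%E.
  move: h => /fine_cvgP[_ h]; near=> n.
  rewrite -[mu _]fineK ?fin_num_measure// lte_fin.
  by near: n; move/cvgr_lt: h; exact.
by move=> [n _ hn]; exists n; apply: ltW; apply: hn => /=.
Unshelve. all: by end_near. Qed.

Definition light b r N : set X :=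
  [set x | (mu (bowen_ball T N x r) < (expR (- b * N%:R))%:E)%E].

(** The light points sharing an itinerary with one light point x all lie in the
Bowen ball of x, whose measure is small; so one ball for each itinerary is
enough. *)
Lemma light_cover b r N (S : set X) (M : R) : 0 < r -> codable T N r S M ->
  exists2 U : set (borel X), measurable U &
    S `&` light b r N `<=` U /\ (mu U <= (M * expR (- b * N%:R))%:E)%E.
Proof.
move=> r0 [m mM [f fm fr]].
have /choice[V hV] : forall v, exists V : set (borel X), [/\ measurable V,
    (mu V <= (expR (- b * N%:R))%:E)%E &
    forall x, S x -> light b r N x -> f x = v -> V x].
  move=> v; have [[x [Sx lx fx]]|h] :=
    pselect (exists x, [/\ S x, light b r N x & f x = v]).
    exists (bowen_ball T N x r); split.
    - by apply: open_borel; exact: open_bowen_ball.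
    - exact: ltW.
    - by move=> y Sy ly fy; apply/(bowen_ballP _ _ _ _ r0); apply: fr => //; rewrite fx.
  exists set0; split => //; first by rewrite measure0 lee_fin expR_ge0.
  by move=> x Sx lx fx; exfalso; apply: h; exists x.
exists (\big[setU/set0]_(v < m) V v).
  by apply: bigsetU_measurable => v _; case: (hV v).
split.
  move=> x [Sx lx]; rewrite -bigcup_mkord; exists (f x); first exact: fm.
  by case: (hV (f x)) => _ _; exact.
apply: (@le_trans _ _ (\sum_(v < m) mu (V v))%E).
  by apply: Boole_inequality => v; case: (hV v).
apply: (@le_trans _ _ (\sum_(v < m) (expR (- b * N%:R))%:E)%E).
  by apply: lee_sum => v _; case: (hV v).
rewrite sumEFin lee_fin sumr_const card_ord -[X in X <= _]mulr_natl.
by rewrite ler_wpM2r// expR_ge0.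
Qed.

Lemma geometric_borel_cantelli (U : nat -> set (borel X)) (c rho : R) :
  0 <= c -> 0 <= rho < 1 -> (forall n, measurable (U n)) ->
  (forall n, (mu (U n) <= (c * rho ^+ n)%:E)%E) -> mu (lim_sup_set U) = 0.
Proof.
move=> c0 /andP[rho0 rho1] mU hU; apply: lim_sup_set_cvg0 => //.
apply: (@le_lt_trans _ _ (c / (1 - rho))%:E); last exact: ltry.
apply: lime_le; first exact: is_cvg_nneseries.
near=> n; apply: (@le_trans _ _ (\sum_(0 <= i < n) (c * rho ^+ i)%:E)%E).
  by apply: lee_sum => i _; exact: hU.
rewrite sumEFin lee_fin -mulr_sumr ler_wpM2l//.
have d0 : 0 < 1 - rho by rewrite subr_gt0.
have rho01 : 0 <= rho <= 1 by rewrite rho0 ltW.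
by rewrite -div1r ler_pdivlMr// mulrC; exact: (geometric_sum_le 0 n rho01).
Unshelve. all: by end_near. Qed.

(** The choice of constants is the following: e = (b - a) / 4, then d from
[heavy_codable], then n1 making long blocks cheap, then a frequency g of
uncovered times with g ln Q <= e, and last n2 making the exceptional set so
small that it is visited with frequency above g only on a set of measure at
most t. *)
Lemma heavy_light_small a b r (t : R) : 0 <= a < b -> 0 < r -> 0 < t ->
  exists2 Z : set (borel X), measurable Z & (mu Z <= t%:E)%E /\
    recurrently_heavy a `&` lim_sup_set (light b r) `<=` Z.
Proof.
move=> /andP[a0 ab] r0 t0.
have [K K0 hK] := compact_codable T cX r0.
pose e := (b - a) / 4; have e0 : 0 < e by rewrite divr_gt0// subr_gt0.
have [d0 d00 hd0] := heavy_codable mu cT a cX e0 r0.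
have [k dk] : exists k, k.+1%:R^-1 <= d0.
  exists (Num.truncn d0^-1); rewrite -[leRHS]invrK lef_pV2 ?posrE ?invr_gt0//.
  by apply: ltW; rewrite real_truncnS_gt ?num_real.
set d := k.+1%:R^-1 in dk.
have {hd0} hcod n : codable T n r (heavy T mu a d n) (expR (a + e) ^+ n).
  by apply: hd0; rewrite invr_gt0 ltr0n.
pose P := expR (a + 2 * e).
have P1 : 1 <= P by rewrite -expR0 ler_expR; lra.
have P0 : 0 < P by rewrite expR_gt0.
have rho01 : 0 <= expR (- e) < 1 by rewrite expR_ge0 -expR0 ltr_expR oppr_lt0.
have [n1 n10 hn1] := geometric_tail_le rho01.
pose Q := 2 * K + 1; have Q1 : 1 <= Q by rewrite /Q; lra.
have Q0 : 0 < Q by lra.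
have lnQ0 : 0 <= ln Q by rewrite ln_ge0.
pose g := e / (ln Q + 1).
have g0 : 0 < g by rewrite divr_gt0// ltr_wpDl.
have gQ : g * ln Q <= e.
  rewrite /g mulrAC ler_pdivrMr ?ltr_wpDl// ler_wpM2l ?ltW// ltrDl//.
have [n2 hn2] := small_exceptional_set a k n1 (mulr_gt0 g0 t0).
set F := _ `\` _ in hn2.
have mF : measurable (F : set (borel X)).
  apply: measurableD; first exact: measurable_recurrently_heavy.
  by apply: bigcup_measurable => n _; exact: measurable_heavy.
have [E mE [muE hE]] := maximal_inequality_infinite cT invT mF g0.
pose bd N := (Num.truncn (g * N%:R) + n2)%N.
have tc N := tiled_codable (O := heavy T mu a d) (n2 := n2) N (bd N)
  hK K0 (expR_ge0 (a + e)) P1 Q1 n10 (fun n _ => hcod n).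
have {tc} tc N : codable T N r [set x | tiled T (heavy T mu a d) n1 n2 N (bd N) x]
    (P ^+ N * Q ^+ bd N).
  apply: tc; first by rewrite /Q; nra.
  rewrite (_ : expR (a + e) / P = expR (- e)); first exact: hn1.
  by rewrite -expRN -expRD; congr expR; ring.
have /choice[U hU] : forall N, exists U : set (borel X), [/\ measurable U,
   [set x | tiled T (heavy T mu a d) n1 n2 N (bd N) x] `&` light b r N `<=` U &
   (mu U <= (P ^+ N * Q ^+ bd N * expR (- b * N%:R))%:E)%E].
  by move=> N; have [U mU [hU hU']] := light_cover b r0 (tc N); exists U.
have mU N : measurable (U N) by case: (hU N).
have muU N : (mu (U N) <= (Q ^+ n2 * expR (- e) ^+ N)%:E)%E.
  have [_ _ /le_trans] := hU N; apply; rewrite lee_fin.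
  have bN : (Num.truncn (g * N%:R))%:R <= g * N%:R.
    by rewrite truncn_le mulr_ge0// ltW.
  rewrite /bd exprD -{1}(@lnK _ Q) ?posrE// -expRM_natr.
  rewrite /P -!expRM_natr [_ * Q ^+ n2]mulrC mulrCA -mulrA.
  rewrite ler_wpM2l ?exprn_ge0 ?(ltW Q0)//.
  rewrite -!expRD ler_expR.
  have : ln Q * (Num.truncn (g * N%:R))%:R <= e * N%:R.
    apply: (@le_trans _ _ (ln Q * (g * N%:R))); first by rewrite ler_wpM2l.
    by rewrite mulrA ler_wpM2r// mulrC.
  have : b = a + 4 * e by rewrite /e; field.
  by move=> ->; set u := ln Q * _; lra.
exists (E `|` lim_sup_set U).
  apply: measurableU => //; apply: bigcapT_measurable => n.
  by apply: bigcup_measurable => j _.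
split.
  apply: (le_trans (measureU2 _ _ _)) => //.
    by apply: bigcapT_measurable => n; apply: bigcup_measurable => j _.
  have Qn0 : 0 <= Q ^+ n2 by rewrite exprn_ge0// ltW.
  rewrite [X in (_ + X)%E](geometric_borel_cantelli Qn0 rho01 mU muU) adde0.
  by rewrite -(@lee_pmul2l _ g%:E) ?lte_fin//; apply: (le_trans muE); rewrite -EFinM.
move=> x [Ax lx]; have [Ex|nEx] := pselect (E x); [by left|right].
move=> n _; have [N /= nN lN] := lx n I; exists N => //.
have [_ + _] := hU N; apply; split => //=.
apply: (@tiled_weaken _ _ _ _ _ _ _ (visits T F N x + n2)%N).
  rewrite /bd leq_add2r truncn_ge_nat; first exact: hE.
  by rewrite mulr_ge0// ltW.
apply: greedy_tiling => // i nF.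
have Ai := recurrently_heavy_iter i Ax.
by apply: contrapT => nh; apply: nF; split.
Qed.

Lemma heavy_light_negligible a b r : 0 <= a < b -> 0 < r ->
  mu.-negligible (recurrently_heavy a `&` lim_sup_set (light b r) : set (borel X)).
Proof.
move=> ab r0.
have /choice[Z hZ] : forall k, exists Z : set (borel X), [/\ measurable Z,
    (mu Z <= (k.+1%:R^-1)%:E)%E &
    recurrently_heavy a `&` lim_sup_set (light b r) `<=` Z].
  move=> k; have k0 : 0 < k.+1%:R^-1 :> R by rewrite invr_gt0.
  by have [Z mZ [h h']] := heavy_light_small ab r0 k0; exists Z.
have mZ : measurable (\bigcap_k Z k).
  by apply: bigcapT_measurable => k; case: (hZ k).
exists (\bigcap_k Z k); split => //.
  apply/eqP; rewrite eq_le measure_ge0 andbT; apply/lee_addgt0Pr => e e0.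
  rewrite add0e; have [_ h _] := hZ (Num.truncn e^-1).
  apply: (@le_trans _ _ (mu (Z (Num.truncn e^-1)))).
    apply: le_measure; rewrite ?inE//; first by case: (hZ (Num.truncn e^-1)).
    exact: bigcap_inf.
  apply: (le_trans h); rewrite lee_fin -[leRHS]invrK lef_pV2 ?posrE ?invr_gt0//.
  by apply: ltW; rewrite real_truncnS_gt ?num_real.
by move=> x h k _; case: (hZ k) => _ _; exact.
Qed.

End NullSet.

(** * Comparison of the local rates *)

Section Limsup.
Context {R : realType}.
Implicit Types (u v : nat -> \bar R) (l : \bar R).
Local Open Scope ereal_scope.

Lemma limn_esup_le u v : (forall n, u n <= v n) -> limn_esup u <= limn_esup v.
Proof.
move=> uv; rewrite /limn_esup !limf_esupE; apply: le_ereal_inf_tmp => _ [V FV <-].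
apply: le_trans (ereal_inf_lbound _) _; first by exists V.
apply: ge_ereal_sup => _ [n Vn <-]; apply: (le_trans (uv n)).
by apply: ereal_sup_ubound; exists n.
Qed.

Lemma limn_einf_le u v : (forall n, u n <= v n) -> limn_einf u <= limn_einf v.
Proof.
by move=> uv; rewrite /limn_einf leeN2; apply: limn_esup_le => n; rewrite leeN2.
Qed.

Lemma limn_esup_frequently u l : l < limn_esup u ->
  forall m, exists2 n, (m <= n)%N & l < u n.
Proof.
move=> lu m; apply: contrapT => h; move: lu; apply/negP; rewrite -leNgt.
rewrite /limn_esup limf_esupE; apply: le_trans (ereal_inf_lbound _) _.
  exists [set n | (m <= n)%N]; last by [].
  exact: nbhs_infty_ge.
apply: ge_ereal_sup => _ [n /= mn <-]; rewrite leNgt; apply/negP => lun.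
by apply: h; exists n.
Qed.

Lemma limn_einf_frequently u l : limn_einf u < l ->
  forall m, exists2 n, (m <= n)%N & u n < l.
Proof.
rewrite /limn_einf lteNl => /limn_esup_frequently h m.
by have [n mn] := h m; rewrite /= lteN2 => ?; exists n.
Qed.

End Limsup.

Section LocalRates.
Context {R : realType} {X : pointedMetricType R} (T : X -> X)
  (mu : probability (borel X) R).
Context (cX : compact [set: X]) (cT : continuous T)
  (invT : invariant_measure T mu).
Implicit Types (x y z : X) (n m k : nat) (a b d r : R) (A B : nat -> set X).

Lemma decay_rate_le A B n :
  measurable (A n : set (borel X)) -> measurable (B n : set (borel X)) ->
  ((0 < n)%N -> A n `<=` B n) -> (decay_rate mu B n <= decay_rate mu A n)%E.
Proof.
case: n => [|n] mA mB AB; first by rewrite /decay_rate invr0 !mule0.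
apply: lee_wpmul2r; first by rewrite lee_fin.
rewrite leeN2 lee_lne ?in_itv/= ?measure_ge0 ?leey//.
by apply: le_measure; rewrite ?inE//; exact: AB.
Qed.

Lemma decay_rate_ge0 A n : measurable (A n : set (borel X)) ->
  (0 <= decay_rate mu A n)%E.
Proof.
by move=> mA; rewrite mule_ge0 ?lee_fin// oppe_ge0 lne_le0 probability_le1.
Qed.

Lemma decay_rate_lt A n a : (0 < n)%N -> measurable (A n : set (borel X)) ->
  (decay_rate mu A n < a%:E)%E -> ((expR (- a * n%:R))%:E < mu (A n))%E.
Proof.
move=> n0 mA; rewrite /decay_rate -[mu _]fineK ?fin_num_measure//.
set v := fine _; have [v0|v0] := leP v 0.
  by rewrite le0_lneNy ?lee_fin//= mulyr gtr0_sg ?invr_gt0 ?ltr0n// mul1e.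
rewrite lne_EFin// -EFinN -EFinM !lte_fin ltr_pdivrMr ?ltr0n// => h.
by rewrite -[ltRHS](@lnK _ v) ?posrE// ltr_expR mulNr ltrNl.
Qed.

Lemma decay_rate_gt A n a : (0 < n)%N -> measurable (A n : set (borel X)) ->
  (a%:E < decay_rate mu A n)%E -> (mu (A n) < (expR (- a * n%:R))%:E)%E.
Proof.
move=> n0 mA; rewrite /decay_rate -[mu _]fineK ?fin_num_measure//.
set v := fine _; have [v0|v0] := leP v 0.
  by move=> _; rewrite lte_fin (le_lt_trans v0)// expR_gt0.
rewrite lne_EFin// -EFinN -EFinM !lte_fin ltr_pdivlMr ?ltr0n// => h.
by rewrite -[ltLHS](@lnK _ v) ?posrE// ltr_expR mulNr ltrNr.
Qed.

(** The limit of f at 0+ when f is nonincreasing. *)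
Definition small_scale (f : R -> \bar R) : \bar R :=
  ereal_sup (f @` [set d | 0 < d]).

Lemma small_scale_le (f g : R -> \bar R) :
  (forall d, 0 < d -> (f d <= g d)%E) -> (small_scale f <= small_scale g)%E.
Proof.
move=> fg; apply: ge_ereal_sup => _ [d d0 <-]; apply: (le_trans (fg d d0)).
by apply: ereal_sup_ubound; exists d.
Qed.

Lemma small_scale_cvg (f : R -> \bar R) :
  (forall d e, 0 < d -> d <= e -> (f e <= f d)%E) ->
  f d @[d --> 0^'+] --> small_scale f.
Proof.
move=> hf; rewrite /small_scale.
have := @nonincreasing_at_right_cvge R f 0 +oo%O (ltac:(by [])).
rewrite (_ : [set` Interval (BRight 0) +oo%O] = [set d | 0 < d]).
  apply; move=> d e; rewrite !in_itv /= !andbT => d0 e0 de; exact: hf.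
by apply/seteqP; split => d /=; rewrite in_itv /= andbT.
Qed.

Lemma measurable_bowen_ball n x d :
  measurable (bowen_ball T n x d : set (borel X)).
Proof. by apply: open_borel; exact: open_bowen_ball. Qed.

Lemma measurable_fk_ball n x d : measurable (fk_ball T n x d : set (borel X)).
Proof. by apply: open_borel; exact: open_fk_ball. Qed.

Lemma fk_lower_heavy a x :
  (small_scale (fk_lower T mu x) < a%:E)%E -> recurrently_heavy T mu a x.
Proof.
move=> h k _ n _.
have d0 : 0 < k.+1%:R^-1 :> R by rewrite invr_gt0.
have : (fk_lower T mu x k.+1%:R^-1 < a%:E)%E.
  by apply: le_lt_trans h; apply: ereal_sup_ubound; exists k.+1%:R^-1.
move=> /limn_einf_frequently/(_ n.+1)[j nj hj].
exists j => /=; first exact: ltnW.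
exists x; last exact: edit_ball_center.
rewrite /=; apply: lt_le_trans (decay_rate_lt _ _ hj) _ => //.
- by apply: leq_trans nj.
- exact: measurable_fk_ball.
- apply: le_measure; rewrite ?inE.
  + exact: measurable_fk_ball.
  + exact: measurable_edit_ball.
  + exact: fk_ball_sub_edit_ball.
Qed.

Lemma bowen_upper_light b x : (b%:E < small_scale (bowen_upper T mu x))%E ->
  exists k, lim_sup_set (light T mu b k.+1%:R^-1) x.
Proof.
move=> /ereal_sup_gt[_ [d /= d0 <-] hd].
exists (Num.truncn d^-1) => n _.
set r := _^-1; have r0 : 0 < r by rewrite invr_gt0.
have rd : r <= d.
  rewrite -[leRHS]invrK lef_pV2 ?posrE ?invr_gt0//.
  by apply: ltW; rewrite real_truncnS_gt ?num_real.
have : (b%:E < bowen_upper T mu x r)%E.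
  apply: (lt_le_trans hd); apply: limn_esup_le => j.
  apply: decay_rate_le; try exact: measurable_bowen_ball.
  by move=> _; exact: bowen_ball_le.
move=> /limn_esup_frequently/(_ n.+1)[j nj hj].
exists j => /=; first exact: ltnW.
apply: decay_rate_gt hj; first exact: leq_trans nj.
exact: measurable_bowen_ball.
Qed.

Lemma small_scale_fk_ge0 x : (0 <= small_scale (fk_lower T mu x))%E.
Proof.
apply: (@le_trans _ _ (fk_lower T mu x 1)); last first.
  by apply: ereal_sup_ubound; exists 1 => /=.
rewrite /fk_lower /limn_einf -oppe0 leeN2.
rewrite -[leRHS](@cvg_limn_einf_sup R (cst 0%E) 0%E (cvg_cst _)).2.
apply: limn_esup_le => n /=; rewrite oppe_le0; apply: decay_rate_ge0.
exact: measurable_fk_ball.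
Qed.

(** Rational bounds are needed to have countably many exceptional null sets. *)
Lemma ereal_gap (s t : \bar R) : (0 <= s < t)%E ->
  exists p q : rat, [/\ 0 <= (ratr p : R) < ratr q,
    (s < (ratr p : R)%:E)%E & ((ratr q : R)%:E < t)%E].
Proof.
move=> /andP[s0 st].
have [u [v [su uv vt]]] : exists u v : R, [/\ s = u%:E, u < v & (v%:E <= t)%E].
  case: s t s0 st => [u| |] [v| |]// s0 st; first by exists u, v.
  by exists u, (u + 1); split => //; [rewrite ltrDl|exact: leey].
move: s0 st; rewrite su lee_fin => u0 _.
have [p] := rat_in_itvoo uv; rewrite in_itv /= => /andP[up pv].
have [q] := rat_in_itvoo pv; rewrite in_itv /= => /andP[pq qv].
exists p, q; split; first by rewrite pq (le_trans u0)// ltW.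
  by rewrite lte_fin.
by apply: lt_le_trans vt; rewrite lte_fin.
Qed.

(** If the inequality fails at x, two rationals p < q separate the two values:
then x is recurrently heavy at rate p and, at some scale 1 / (k + 1), infinitely
often light at rate q.  The union over p, q and k is negligible. *)
Lemma ae_bowen_upper_le_fk_lower :
  {ae mu, forall x,
    (small_scale (bowen_upper T mu x) <= small_scale (fk_lower T mu x))%E}.
Proof.
pose N (i : nat) : set (borel X) :=
  if @unpickle (rat * rat * nat)%type i is Some (p, q, k) then
    if 0 <= (ratr p : R) < ratr q then
      recurrently_heavy T mu (ratr p) `&`
        lim_sup_set (light T mu (ratr q) k.+1%:R^-1)
    else set0
  else set0.
have : mu.-negligible (\bigcup_i N i).
  apply: negligible_bigcup => i; rewrite /N.
  case: unpickle => [[[p q] k]|]; last exact: negligible_set0.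
  case: ifPn => pq; last exact: negligible_set0.
  by apply: heavy_light_negligible.
apply: negligibleS => x /= /negP; rewrite -ltNge => h.
have [|p [q [pq hp hq]]] := ereal_gap (s := small_scale (fk_lower T mu x))
   (t := small_scale (bowen_upper T mu x)).
  by rewrite small_scale_fk_ge0.
have [k hk] := bowen_upper_light hq.
exists (pickle (p, q, k)); first exact: I.
by rewrite /N pickleK pq; split; [exact: fk_lower_heavy|exact: hk].
Qed.

End LocalRates.

Theorem theorem2p9 (R : realType) (X : pointedMetricType R) (T : X -> X)
    (mu : probability (borel X) R) :
  compact [set: X] -> continuous T -> invariant_measure T mu ->
  {ae mu, forall x, exists h : \bar R,
    [/\ is_local_entropy T mu x h,
        fk_lower T mu x delta @[delta --> 0^'+] --> h &
        fk_upper T mu x delta @[delta --> 0^'+] --> h]}.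
Proof.
move=> cX cT invT; have := ae_bowen_upper_le_fk_lower cX cT invT.
apply: negligibleS; apply: subsetC => x /= bu_fl.
pose bl := bowen_lower T mu x; pose bu := bowen_upper T mu x.
pose fl := fk_lower T mu x; pose fu := fk_upper T mu x.
have mb n d : measurable (bowen_ball T n x d : set (borel X)).
  exact: measurable_bowen_ball.
have mf n d : measurable (fk_ball T n x d : set (borel X)).
  exact: measurable_fk_ball.
have bl_bu : (small_scale bl <= small_scale bu)%E.
  by apply: small_scale_le => d _; exact: limn_einf_sup.
have fl_fu : (small_scale fl <= small_scale fu)%E.
  by apply: small_scale_le => d _; exact: limn_einf_sup.
have fl_bl : (small_scale fl <= small_scale bl)%E.
  apply: small_scale_le => d d0; apply: limn_einf_le => n.
  by apply: decay_rate_le => // n0; exact: bowen_ball_sub_fk_ball.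
have fu_bu : (small_scale fu <= small_scale bu)%E.
  apply: small_scale_le => d d0; apply: limn_esup_le => n.
  by apply: decay_rate_le => // n0; exact: bowen_ball_sub_fk_ball.
have eq_bu (f : R -> \bar R) : (small_scale fl <= small_scale f)%E ->
    (small_scale f <= small_scale bu)%E -> small_scale f = small_scale bu.
  by move=> h1 h2; apply/eqP; rewrite eq_le h2 (le_trans bu_fl).
exists (small_scale bu); split; first split.
- rewrite -(eq_bu bl)//; apply: small_scale_cvg => d e d0 de.
  apply: limn_einf_le => n; apply: decay_rate_le => // _; exact: bowen_ball_le.
- apply: small_scale_cvg => d e d0 de.
  apply: limn_esup_le => n; apply: decay_rate_le => // _; exact: bowen_ball_le.
- rewrite -(eq_bu fl)//; last exact: le_trans bl_bu.
  apply: small_scale_cvg => d e d0 de.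
  apply: limn_einf_le => n; apply: decay_rate_le => // _; exact: fk_ball_le.
- rewrite -(eq_bu fu)//; apply: small_scale_cvg => d e d0 de.
  apply: limn_esup_le => n; apply: decay_rate_le => // _; exact: fk_ball_le.
Qed.
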